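(* Let $b\in(0,1)$ and let $(x_0,y_0)\in(-1,1)\times(-b,b)$ satisfy $x_0^2+\frac{y_0^2}{b^2}<1$. Let $D\subset\mathbb{R}^2$ be the elliptic domain whose boundary is parameterised by $$\gamma(\xi)=(\cos\xi+x_0,\ b\sin\xi+y_0),\qquad \xi\in[0,2\pi].$$ Then $D$ is not admissible if and only if $$\Big(x_0=0\ \text{ and }\ |y_0|\ge \frac{1-b^2}{b}\Big)\quad\text{or}\quad \Big(y_0=0\ \text{ and }\ |x_0|\ge 1-b^2\Big).$$
   Context: Let $D\subset\mathbb{R}^2$ be a bounded domain containing the origin in its interior (for the ellipse this is the condition $x_0^2+y_0^2/b^2<1$), with simple $C^2$ boundary parameterised by $\gamma=\gamma(\xi)$, $\xi\in[a,b']$, $\gamma(a)=\gamma(b')$ (the endpoints being identified as the same parameter value). A central configuration (c.c.) is a value $\bar\xi$ of the parameter such that: (i) $\overline P=\gamma(\bar\xi)$ is a constrained critical point of the Euclidean norm restricted to the boundary, $|\cdot|_{|\partial D}$, i.e. the position vector $\overline P$ is orthogonal to $\partial D$ at $\overline P$; (ii) the half-line from the origin through $\overline P$ intersects $\partial D$ only at $\overline P$. A central configuration $\bar\xi$ is non degenerate if the second differential of $|\cdot|_{|\partial D}$ is not degenerate at $\overline P$. The domain $D$ is admissible if there exist at least two non degenerate central configurations corresponding to a pair of points of $\partial D$ that are not aligned with the origin (i.e. that are not antipodal with respect to the origin). *)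

(* Defs.v *)
(* The plane is R * R; Coquelicot's [norm] on it
   is the Euclidean one (lemma [norm_plane]) and [locally] its usual topology. *)
From Stdlib Require Import Reals Lra.
From Coquelicot Require Import Coquelicot.
Open Scope R_scope.

Definition boundary (D : R * R -> Prop) (P : R * R) : Prop :=
  ~ locally P D /\ ~ locally P (fun Q => ~ D Q).

Definition half_line (P Q : R * R) : Prop :=
  exists t : R, 0 <= t /\ Q = scal t P.

Definition aligned_with_origin (P Q : R * R) : Prop :=
  exists (u : R * R) (s t : R), P = scal s u /\ Q = scal t u.

(* In the three definitions below [gamma] parameterises the boundary of [D] over
   [[a, b']] and is extended (b' - a)-periodically to R: this is how the two
   endpoints are identified, and why two-sided derivatives make sense there.
   The first and second differentials of the norm restricted to the boundary are
   read in the coordinate xi given by [gamma], a regular C^2 parameterisation. *)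
Definition central_configuration (D : R * R -> Prop) (a b' : R)
    (gamma : R -> R * R) (xi : R) : Prop :=
  a <= xi <= b' /\
  is_derive (fun s : R => norm (gamma s)) xi 0 /\
  (forall Q : R * R, half_line (gamma xi) Q /\ boundary D Q <-> Q = gamma xi).

Definition nondegenerate_cc (D : R * R -> Prop) (a b' : R)
    (gamma : R -> R * R) (xi : R) : Prop :=
  central_configuration D a b' gamma xi /\
  exists l : R, is_derive_n (fun s : R => norm (gamma s)) 2 xi l /\ l <> 0.

Definition admissible (D : R * R -> Prop) (a b' : R) (gamma : R -> R * R) : Prop :=
  exists xi1 xi2 : R,
    nondegenerate_cc D a b' gamma xi1 /\ nondegenerate_cc D a b' gamma xi2 /\
    ~ aligned_with_origin (gamma xi1) (gamma xi2).

Definition elliptic_domain (b x0 y0 : R) (P : R * R) : Prop :=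
  (fst P - x0) ^ 2 + (snd P - y0) ^ 2 / b ^ 2 < 1.

Definition ellipse_param (b x0 y0 xi : R) : R * R :=
  (cos xi + x0, b * sin xi + y0).

Lemma norm_plane (P : R * R) : norm P = sqrt (fst P ^ 2 + snd P ^ 2).
Proof.
destruct P as [x y].
change (sqrt (Rabs x ^ 2 + Rabs y ^ 2) = sqrt (x ^ 2 + y ^ 2)).
now rewrite !pow2_abs.
Qed.

Lemma ellipse_param_periodic (b x0 y0 xi : R) :
  ellipse_param b x0 y0 (xi + 2 * PI) = ellipse_param b x0 y0 xi.
Proof.
unfold ellipse_param. now rewrite cos_plus, sin_plus, cos_2PI, sin_2PI, !Rmult_0_r,
  !Rmult_1_r, Rminus_0_r, Rplus_0_r.
Qed.

Lemma ellipse_param_inj (b x0 y0 xi eta : R) :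
  0 < b -> 0 <= xi < 2 * PI -> 0 <= eta < 2 * PI ->
  ellipse_param b x0 y0 xi = ellipse_param b x0 y0 eta -> xi = eta.
Proof.
intros Hb Hx He E. injection E as Ec Es.
assert (Hc : cos xi = cos eta) by lra.
assert (Hs : sin xi = sin eta) by (apply Rmult_eq_reg_l with b; lra).
assert (H1 : cos (2 * ((xi - eta) / 2)) = 1).
{ replace (2 * ((xi - eta) / 2)) with (xi - eta) by field.
  rewrite cos_minus, Hc, Hs. pose proof (sin2_cos2 eta). unfold Rsqr in *. lra. }
rewrite cos_2a_sin in H1.
assert (H0 : sin ((xi - eta) / 2) = 0) by nra.
destruct (Rtotal_order xi eta) as [L|[L|L]]; trivial.
- assert (0 < sin (- ((xi - eta) / 2))) by (apply sin_gt_0; lra).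
  rewrite sin_neg in *; lra.
- assert (0 < sin ((xi - eta) / 2)) by (apply sin_gt_0; lra). lra.
Qed.

Lemma unit_circle_param (u v : R) :
  u ^ 2 + v ^ 2 = 1 -> exists xi, 0 <= xi <= 2 * PI /\ u = cos xi /\ v = sin xi.
Proof.
intros H. assert (Hu : -1 <= u <= 1) by nra.
pose proof (acos_bound u) as B.
assert (Hs : sin (acos u) = Rabs v).
{ rewrite sin_acos by trivial. rewrite <- sqrt_Rsqr_abs. f_equal. unfold Rsqr; lra. }
destruct (Rle_dec 0 v) as [Hv|Hv].
- exists (acos u). rewrite cos_acos, Hs, Rabs_pos_eq by lra. repeat split; lra.
- exists (- acos u + 2 * PI).
  rewrite cos_plus, sin_plus, cos_2PI, sin_2PI, cos_neg, sin_neg, cos_acos, Hs,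
    Rabs_left by lra. repeat split; lra.
Qed.

Lemma elliptic_domain_boundary (b x0 y0 : R) (P : R * R) :
  0 < b ->
  boundary (elliptic_domain b x0 y0) P <->
  exists xi, 0 <= xi <= 2 * PI /\ P = ellipse_param b x0 y0 xi.
Proof.
intros Hb.
set (q := fun P : R * R =>
  (fst P - x0) * (fst P - x0) + (snd P - y0) * (snd P - y0) * / b ^ 2).
assert (Hq : forall P, (fst P - x0) ^ 2 + (snd P - y0) ^ 2 / b ^ 2 = q P).
{ intros Q. unfold q. field. lra. }
assert (Cq : continuous q P).
{ unfold q.
  assert (C1 : continuous (fun P : R * R => fst P - x0) P).
  { apply (continuous_minus (V := R_NormedModule)). apply continuous_fst.
    apply continuous_const. }
  assert (C2 : continuous (fun P : R * R => snd P - y0) P).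
  { apply (continuous_minus (V := R_NormedModule)). apply continuous_snd.
    apply continuous_const. }
  apply (continuous_plus (V := R_NormedModule)).
  - now apply (continuous_mult (K := R_AbsRing)).
  - apply (continuous_mult (K := R_AbsRing)); [|apply continuous_const].
    now apply (continuous_mult (K := R_AbsRing)). }
split.
- intros [H1 H2].
  assert (E : q P = 1).
  { destruct (Rtotal_order (q P) 1) as [L|[L|L]]; trivial; exfalso.
    - apply H1. apply filter_imp with (fun Q => q Q < 1).
      + intros Q HQ. unfold elliptic_domain. now rewrite Hq.
      + apply (Cq (fun r => r < 1)). now apply open_lt.
    - apply H2. apply filter_imp with (fun Q => 1 < q Q).
      + intros Q HQ. unfold elliptic_domain. rewrite Hq. lra.
      + apply (Cq (fun r => 1 < r)). now apply open_gt. }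
  destruct (unit_circle_param (fst P - x0) ((snd P - y0) / b)) as [xi [Hx [Hc Hs]]].
  { rewrite <- E. unfold q. field. lra. }
  exists xi. split; trivial. destruct P as [x y]; simpl in *.
  unfold ellipse_param. rewrite <- Hc, <- Hs. f_equal; field. lra.
- intros [xi [_ ->]]. pose proof (sin2_cos2 xi) as SC. unfold Rsqr in SC. split.
  + intros H. apply locally_singleton in H. unfold elliptic_domain in H.
    rewrite Hq in H. unfold q in H; simpl in H.
    replace ((cos xi + x0 - x0) * (cos xi + x0 - x0) +
      (b * sin xi + y0 - y0) * (b * sin xi + y0 - y0) * / (b * (b * 1))) with
      (sin xi * sin xi + cos xi * cos xi) in H by (field; lra). lra.
  + intros [[e He] H].
    set (m := Rmin 1 (e / (2 * (1 + b)))).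
    assert (Hm0 : 0 < e / (2 * (1 + b))) by (apply Rdiv_lt_0_compat; lra).
    assert (Hm : 0 < m) by (apply Rmin_pos; lra).
    assert (Hm1 : m <= 1) by apply Rmin_l.
    assert (Hme : m * (1 + b) < e).
    { apply Rle_lt_trans with (e / (2 * (1 + b)) * (1 + b)).
      - apply Rmult_le_compat_r; [lra|apply Rmin_r].
      - replace (e / (2 * (1 + b)) * (1 + b)) with (e / 2) by (field; lra). lra. }
    pose proof (COS_bound xi) as CB. pose proof (SIN_bound xi) as SB.
    apply (H ((1 - m) * cos xi + x0, (1 - m) * (b * sin xi) + y0)).
    * split; simpl; unfold ball; simpl; unfold AbsRing_ball, abs, minus, plus, opp; simpl.
      -- replace ((1 - m) * cos xi + x0 + - (cos xi + x0)) with (- (m * cos xi)) by ring.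
         apply Rabs_def1; nra.
      -- replace ((1 - m) * (b * sin xi) + y0 + - (b * sin xi + y0))
           with (- (m * b * sin xi)) by ring.
         assert (0 < m * b) by nra. apply Rabs_def1; nra.
    * unfold elliptic_domain. rewrite Hq. unfold q; simpl.
      replace (((1 - m) * cos xi + x0 - x0) * ((1 - m) * cos xi + x0 - x0) +
        ((1 - m) * (b * sin xi) + y0 - y0) * ((1 - m) * (b * sin xi) + y0 - y0) *
        / (b * (b * 1))) with
        ((1 - m) * (1 - m) * (sin xi * sin xi + cos xi * cos xi)) by (field; lra).
      rewrite SC. nra.
Qed.

(* Main.v *)
Require Import Defs.
From Stdlib Require Import Reals Lra Psatz.
From Coquelicot Require Import Coquelicot.
Open Scope R_scope.

(** Half the squared norm of [ellipse_param b x0 y0 xi] is, up to an additive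
    constant, [A u + B v + K / 2 u^2] at [(u, v) = (cos xi, sin xi)], with
    [A = x0], [B = b y0] and [K = 1 - b^2 > 0].  As the origin is inside the
    ellipse, the norm never vanishes on the boundary, so it has the same critical
    points, with the same degenerate ones, and each half-line from the origin
    meets the ellipse once by convexity.  The question is thus one about this
    trigonometric polynomial ([nondegenerate_cc_intro],
    [central_configuration_slope]).

    If the origin lies on an axis of the ellipse, the equation of critical points
    factors: besides the two ends of that axis it has a symmetric pair of
    solutions, outside the axis and nondegenerate, which exists exactly
    below the stated threshold.  Without this pair, all central configurations
    lie on one line through the origin; with it, two of them are not aligned.

    If the origin lies on no axis, the maximum and the minimum of the norm work.
    They are nondegenerate because a degenerate extremum would be an extremum with
    vanishing third derivative, which requires the origin to be a cusp of the
    evolute, and those lie on the axes ([exists_nondegenerate_max]).  They are not aligned with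
    the origin because a chord normal to the ellipse at both ends is an axis
    ([normal_chord_on_axis]). *)

(** * A trigonometric polynomial on the unit circle *)

Definition energy (A B K u v : R) : R := A * u + B * v + K / 2 * u ^ 2.

Definition slope (A B K u v : R) : R := B * u - A * v - K * u * v.

Definition curvature (A B K u v : R) : R := - (A * u + B * v) - K * (u ^ 2 - v ^ 2).

Lemma is_derive_energy (A B K xi : R) :
  is_derive (fun s => energy A B K (cos s) (sin s)) xi
    (slope A B K (cos xi) (sin xi)).
Proof. unfold energy, slope. auto_derive; trivial. field. Qed.

Lemma is_derive_slope (A B K xi : R) :
  is_derive (fun s => slope A B K (cos s) (sin s)) xi
    (curvature A B K (cos xi) (sin xi)).
Proof. unfold curvature, slope. auto_derive; trivial. ring. Qed.

Lemma sum_sq_cos_sin (xi : R) : cos xi ^ 2 + sin xi ^ 2 = 1.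
Proof. pose proof (sin2_cos2 xi). unfold Rsqr in *. lra. Qed.

Lemma exists_energy_max (A B K : R) :
  exists xi, 0 <= xi <= 2 * PI /\
    forall u v, u ^ 2 + v ^ 2 = 1 ->
      energy A B K u v <= energy A B K (cos xi) (sin xi).
Proof.
pose proof PI_RGT_0.
destruct (continuity_ab_maj (fun s => energy A B K (cos s) (sin s)) 0 (2 * PI))
  as [xi [Hmax Hxi]].
- lra.
- intros s _. apply derivable_continuous_pt.
  eexists. apply is_derive_Reals, is_derive_energy.
- exists xi. split; trivial. intros u v Huv.
  destruct (unit_circle_param u v Huv) as [eta [He [-> ->]]]. now apply Hmax.
Qed.

Lemma slope_energy_max (A B K xi : R) :
  (forall u v, u ^ 2 + v ^ 2 = 1 ->
    energy A B K u v <= energy A B K (cos xi) (sin xi)) ->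
  slope A B K (cos xi) (sin xi) = 0.
Proof.
intros Hmax.
pose proof (is_derive_energy A B K xi) as Hd. apply is_derive_Reals in Hd.
rewrite <- (derive_pt_eq_0 _ _ _ (exist _ _ Hd) Hd).
apply deriv_maximum with (xi - 1) (xi + 1); try lra.
intros s _ _. apply Hmax, sum_sq_cos_sin.
Qed.

(** At a degenerate critical point [(c, s)], the increment of the energy
    under the rotation whose half-angle has tangent [t] factors: it is of third
    order in [t], with leading coefficient a multiple of [K c s]. *)
Lemma energy_rotation_degenerate (A B K c s t : R) :
  slope A B K c s = 0 -> curvature A B K c s = 0 ->
  let C := (1 - t ^ 2) / (1 + t ^ 2) in
  let S := 2 * t / (1 + t ^ 2) in
  energy A B K (c * C - s * S) (s * C + c * S) - energy A B K c s =
  2 * K * t ^ 3 * (t * (c ^ 2 - s ^ 2) + 2 * (c * s)) / (1 + t ^ 2) ^ 2.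
Proof.
intros Hs Hc C S. unfold slope in Hs. unfold curvature in Hc.
assert (Ht : 1 + t ^ 2 <> 0) by nra.
assert (EC : 1 - C = 2 * t ^ 2 / (1 + t ^ 2)) by (unfold C; field; trivial).
assert (HCS : C ^ 2 + S ^ 2 = 1) by (unfold C, S; field; trivial).
transitivity (K * (1 - C) * (/ 2 * (c ^ 2 - s ^ 2) * (1 - C) + s * c * S)).
- transitivity ((A * c + B * s) * (C - 1) + (B * c - A * s) * S
    + K / 2 * ((c * C - s * S) ^ 2 - c ^ 2)); [unfold energy; ring|].
  replace (A * c + B * s) with (- K * (c ^ 2 - s ^ 2)) by lra.
  replace (B * c - A * s) with (K * c * s) by lra.
  replace ((c * C - s * S) ^ 2)
    with (c ^ 2 * C ^ 2 - 2 * c * s * C * S + s ^ 2 * S ^ 2) by ring.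
  replace (S ^ 2) with (1 - C ^ 2) by lra.
  field.
- rewrite EC. unfold S. field. trivial.
Qed.

(** If a maximum were degenerate, the cubic increment of
    [energy_rotation_degenerate] would force [c s = 0] there, and then
    [slope] would give [A = 0] or [B = 0]. *)
Lemma exists_nondegenerate_max (A B K : R) :
  A <> 0 -> B <> 0 -> K <> 0 ->
  exists xi, 0 <= xi <= 2 * PI /\
    (forall u v, u ^ 2 + v ^ 2 = 1 ->
      energy A B K u v <= energy A B K (cos xi) (sin xi)) /\
    slope A B K (cos xi) (sin xi) = 0 /\
    curvature A B K (cos xi) (sin xi) <> 0.
Proof.
intros HA HB HK.
destruct (exists_energy_max A B K) as [xi [Hxi Hmax]].
pose proof (slope_energy_max A B K xi Hmax) as Hsl.
exists xi. do 3 (split; trivial). intros Hcu.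
pose proof (sum_sq_cos_sin xi) as H1.
set (c := cos xi) in *. set (s := sin xi) in *.
assert (Hcs : c * s <> 0).
{ intros E. unfold slope in Hsl.
  destruct (Rmult_integral _ _ E) as [E0|E0]; rewrite E0 in *.
  - assert (A * s = 0) by lra. assert (s <> 0) by nra. nra.
  - assert (B * c = 0) by lra. assert (c <> 0) by nra. nra. }
(* For [t = e c s] the increment has the sign of [e K (e (c^2 - s^2) + 2)], whose
   last factor is at least [1]; so [e] is taken to be the sign of [K]. *)
assert (Hgen : forall e, e = 1 \/ e = -1 -> 0 < e * K -> False).
{ intros e He HeK.
  set (t := e * (c * s)).
  pose proof (energy_rotation_degenerate A B K c s t Hsl Hcu) as E. cbv zeta in E.
  assert (Ht : 0 < 1 + t ^ 2) by nra.
  set (C := (1 - t ^ 2) / (1 + t ^ 2)) in *.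
  set (S := 2 * t / (1 + t ^ 2)) in *.
  assert (HCS : C ^ 2 + S ^ 2 = 1) by (unfold C, S; field; lra).
  assert (Hle : energy A B K (c * C - s * S) (s * C + c * S) <= energy A B K c s).
  { apply Hmax.
    replace ((c * C - s * S) ^ 2 + (s * C + c * S) ^ 2)
      with ((c ^ 2 + s ^ 2) * (C ^ 2 + S ^ 2)) by ring.
    rewrite H1, HCS. ring. }
  assert (0 < 2 * K * t ^ 3 * (t * (c ^ 2 - s ^ 2) + 2 * (c * s)) / (1 + t ^ 2) ^ 2);
    [|lra].
  apply Rdiv_lt_0_compat; [|now apply pow_lt].
  replace (2 * K * t ^ 3 * (t * (c ^ 2 - s ^ 2) + 2 * (c * s)))
    with (2 * (e * K) * ((c * s) ^ 2) ^ 2 * e ^ 2 * (e * (c ^ 2 - s ^ 2) + 2))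
    by (unfold t; ring).
  replace (e ^ 2) with 1 by (destruct He as [-> | ->]; ring).
  assert (0 < (c * s) ^ 2) by nra.
  assert (0 < ((c * s) ^ 2) ^ 2) by (apply pow_lt; trivial).
  assert (0 < e * (c ^ 2 - s ^ 2) + 2).
  { pose proof (pow2_ge_0 c). pose proof (pow2_ge_0 s). destruct He as [-> | ->]; lra. }
  repeat (apply Rmult_lt_0_compat; [|lra]). lra. }
destruct (Rtotal_order K 0) as [L|[L|L]]; [|lra|].
- apply (Hgen (-1)); lra.
- apply (Hgen 1); lra.
Qed.

(** * From the norm on the ellipse to the polynomial *)

Lemma origin_not_on_ellipse (b x0 y0 u v : R) :
  0 < b -> x0 ^ 2 + y0 ^ 2 / b ^ 2 < 1 -> u ^ 2 + v ^ 2 = 1 ->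
  0 < (u + x0) ^ 2 + (b * v + y0) ^ 2.
Proof.
intros hb hin H1.
pose proof (pow2_ge_0 (u + x0)). pose proof (pow2_ge_0 (b * v + y0)).
destruct (Req_dec (u + x0) 0) as [E|E];
  [|pose proof (pow2_gt_0 _ E); lra].
destruct (Req_dec (b * v + y0) 0) as [F|F];
  [exfalso|pose proof (pow2_gt_0 _ F); lra].
replace x0 with (- u) in hin by lra. replace y0 with (- (b * v)) in hin by lra.
replace ((- u) ^ 2 + (- (b * v)) ^ 2 / b ^ 2) with (u ^ 2 + v ^ 2) in hin
  by (field; lra). lra.
Qed.

Lemma norm_ellipse_pos (b x0 y0 xi : R) :
  0 < b -> x0 ^ 2 + y0 ^ 2 / b ^ 2 < 1 -> 0 < norm (ellipse_param b x0 y0 xi).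
Proof.
intros hb hin. rewrite norm_plane. apply sqrt_lt_R0.
apply origin_not_on_ellipse; trivial. apply sum_sq_cos_sin.
Qed.

Lemma is_derive_norm_ellipse (b x0 y0 xi : R) :
  0 < b -> x0 ^ 2 + y0 ^ 2 / b ^ 2 < 1 ->
  is_derive (fun s => norm (ellipse_param b x0 y0 s)) xi
    (slope x0 (b * y0) (1 - b ^ 2) (cos xi) (sin xi) / norm (ellipse_param b x0 y0 xi)).
Proof.
intros hb hin.
pose proof (origin_not_on_ellipse b x0 y0 _ _ hb hin (sum_sq_cos_sin xi)) as Hp.
apply is_derive_ext with (fun s => sqrt ((cos s + x0) ^ 2 + (b * sin s + y0) ^ 2)).
{ intros s. now rewrite norm_plane. }
rewrite norm_plane. unfold ellipse_param, slope; simpl fst; simpl snd.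
pose proof (sqrt_lt_R0 _ Hp).
auto_derive; [simpl in *; lra|].
simpl in *. field. lra.
Qed.

Lemma is_derive2_norm_ellipse (b x0 y0 xi : R) :
  0 < b -> x0 ^ 2 + y0 ^ 2 / b ^ 2 < 1 ->
  slope x0 (b * y0) (1 - b ^ 2) (cos xi) (sin xi) = 0 ->
  is_derive_n (fun s => norm (ellipse_param b x0 y0 s)) 2 xi
    (curvature x0 (b * y0) (1 - b ^ 2) (cos xi) (sin xi)
      / norm (ellipse_param b x0 y0 xi)).
Proof.
intros hb hin Hs. unfold is_derive_n.
pose proof (norm_ellipse_pos b x0 y0 xi hb hin) as Hp.
apply is_derive_ext with
  (fun s => slope x0 (b * y0) (1 - b ^ 2) (cos s) (sin s)
    / norm (ellipse_param b x0 y0 s)).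
{ intros s. symmetry. apply is_derive_unique. now apply is_derive_norm_ellipse. }
evar_last.
- apply is_derive_div; [apply is_derive_slope|now apply is_derive_norm_ellipse|lra].
- cbv beta. rewrite Hs. field. lra.
Qed.

Lemma central_configuration_slope (b x0 y0 xi : R) (D : R * R -> Prop) :
  0 < b -> x0 ^ 2 + y0 ^ 2 / b ^ 2 < 1 ->
  central_configuration D 0 (2 * PI) (ellipse_param b x0 y0) xi ->
  slope x0 (b * y0) (1 - b ^ 2) (cos xi) (sin xi) = 0.
Proof.
intros hb hin [_ [Hd _]].
pose proof (norm_ellipse_pos b x0 y0 xi hb hin) as Hp.
pose proof (is_derive_norm_ellipse b x0 y0 xi hb hin) as Hd'.
apply is_derive_unique in Hd. apply is_derive_unique in Hd'.
pose proof (eq_trans (eq_sym Hd) Hd') as E.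
rewrite <- (Rmult_0_l (norm (ellipse_param b x0 y0 xi))), E. field. lra.
Qed.

Lemma scal_one_plane (P : R * R) : scal 1 P = P.
Proof.
destruct P as [x y]. unfold scal; simpl. unfold prod_scal, scal; simpl.
unfold mult; simpl. f_equal; ring.
Qed.

(** Along a ray, membership in the ellipse is a quadratic equation whose two roots
    have a negative product, because the origin is inside. *)
Lemma half_line_meets_ellipse_once (b x0 y0 xi : R) (Q : R * R) :
  0 < b -> x0 ^ 2 + y0 ^ 2 / b ^ 2 < 1 -> 0 <= xi <= 2 * PI ->
  half_line (ellipse_param b x0 y0 xi) Q /\ boundary (elliptic_domain b x0 y0) Q <->
  Q = ellipse_param b x0 y0 xi.
Proof.
intros hb hin Hxi. rewrite elliptic_domain_boundary by trivial. split.
- intros [[t [Ht E]] [eta [_ Ee]]].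
  rewrite E in Ee. injection Ee as E1 E2.
  unfold scal in E1, E2; simpl in E1, E2; unfold mult in E1, E2; simpl in E1, E2.
  pose proof (sum_sq_cos_sin xi) as H1. pose proof (sum_sq_cos_sin eta) as H2.
  set (w := y0 / b) in *.
  assert (Hw : y0 = b * w) by (unfold w; field; lra).
  assert (hin' : x0 ^ 2 + w ^ 2 < 1).
  { replace (w ^ 2) with (y0 ^ 2 / b ^ 2) by (unfold w; field; lra). trivial. }
  assert (Ec : cos eta = t * (cos xi + x0) - x0) by lra.
  assert (Es : sin eta = t * (sin xi + w) - w).
  { apply Rmult_eq_reg_l with b; [|lra]. rewrite Hw in E2. lra. }
  rewrite Ec, Es in H2.
  set (al := (cos xi + x0) ^ 2 + (sin xi + w) ^ 2) in *.
  assert (Hf : (t - 1) * (al * t + (1 - (x0 ^ 2 + w ^ 2))) = 0).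
  { transitivity ((t * (cos xi + x0) - x0) ^ 2 + (t * (sin xi + w) - w) ^ 2 - 1
      + t * (1 - (cos xi ^ 2 + sin xi ^ 2))); [unfold al; ring|].
    rewrite H1, H2. ring. }
  assert (Hal : 0 <= al) by (apply Rplus_le_le_0_compat; apply pow2_ge_0).
  assert (Hat : 0 <= al * t) by now apply Rmult_le_pos.
  apply Rmult_integral in Hf. destruct Hf as [Hf|Hf]; [|lra].
  assert (t = 1) as -> by lra.
  rewrite E. apply scal_one_plane.
- intros ->. split.
  + exists 1. split; [lra|]. symmetry. apply scal_one_plane.
  + now exists xi.
Qed.

Lemma nondegenerate_cc_intro (b x0 y0 u v : R) :
  0 < b -> x0 ^ 2 + y0 ^ 2 / b ^ 2 < 1 -> u ^ 2 + v ^ 2 = 1 ->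
  slope x0 (b * y0) (1 - b ^ 2) u v = 0 ->
  curvature x0 (b * y0) (1 - b ^ 2) u v <> 0 ->
  exists xi, ellipse_param b x0 y0 xi = (u + x0, b * v + y0) /\
    nondegenerate_cc (elliptic_domain b x0 y0) 0 (2 * PI) (ellipse_param b x0 y0) xi.
Proof.
intros hb hin H1 Hs Hc.
destruct (unit_circle_param u v H1) as [xi [Hxi [-> ->]]].
pose proof (norm_ellipse_pos b x0 y0 xi hb hin) as Hp.
exists xi. split; [reflexivity|]. split; [split; [trivial|split]|].
- pose proof (is_derive_norm_ellipse b x0 y0 xi hb hin) as Hd.
  rewrite Hs in Hd. unfold Rdiv in Hd. now rewrite Rmult_0_l in Hd.
- intros Q. now apply half_line_meets_ellipse_once.
- eexists. split; [now apply is_derive2_norm_ellipse|].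
  apply Rmult_integral_contrapositive. split; trivial.
  apply Rinv_neq_0_compat. lra.
Qed.

Lemma admissible_intro (b x0 y0 u1 v1 u2 v2 : R) :
  0 < b -> x0 ^ 2 + y0 ^ 2 / b ^ 2 < 1 ->
  u1 ^ 2 + v1 ^ 2 = 1 -> u2 ^ 2 + v2 ^ 2 = 1 ->
  slope x0 (b * y0) (1 - b ^ 2) u1 v1 = 0 ->
  slope x0 (b * y0) (1 - b ^ 2) u2 v2 = 0 ->
  curvature x0 (b * y0) (1 - b ^ 2) u1 v1 <> 0 ->
  curvature x0 (b * y0) (1 - b ^ 2) u2 v2 <> 0 ->
  ~ aligned_with_origin (u1 + x0, b * v1 + y0) (u2 + x0, b * v2 + y0) ->
  admissible (elliptic_domain b x0 y0) 0 (2 * PI) (ellipse_param b x0 y0).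
Proof.
intros hb hin H1 H2 S1 S2 C1 C2 Hal.
destruct (nondegenerate_cc_intro b x0 y0 u1 v1) as [xi1 [E1 N1]]; trivial.
destruct (nondegenerate_cc_intro b x0 y0 u2 v2) as [xi2 [E2 N2]]; trivial.
exists xi1, xi2. now rewrite E1, E2.
Qed.

Lemma aligned_with_origin_det (x1 y1 x2 y2 : R) :
  aligned_with_origin (x1, y1) (x2, y2) -> x1 * y2 = x2 * y1.
Proof.
intros [[p q] [s [t [E1 E2]]]]. injection E1 as -> ->. injection E2 as -> ->.
unfold scal; simpl. unfold mult; simpl. ring.
Qed.

(** * The origin on an axis *)

(** On the vertical axis the slope is [u (b y0 - (1 - b^2) v)], so the pair outside
    the axis is at height [v = b y0 / (1 - b^2)]; at the centre this pair is
    itself aligned, and an end of each axis is taken instead. *)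
Lemma admissible_vertical_axis (b y0 : R) :
  0 < b < 1 -> 0 ^ 2 + y0 ^ 2 / b ^ 2 < 1 -> Rabs y0 < (1 - b ^ 2) / b ->
  admissible (elliptic_domain b 0 y0) 0 (2 * PI) (ellipse_param b 0 y0).
Proof.
intros hb hin H.
assert (HK : 0 < 1 - b ^ 2) by nra.
destruct (Req_dec y0 0) as [->|Hy].
- apply admissible_intro with 1 0 0 1; unfold slope, curvature; trivial; try lra.
  intros Hal. apply aligned_with_origin_det in Hal. lra.
- set (v := b * y0 / (1 - b ^ 2)).
  assert (Ev : b * y0 = (1 - b ^ 2) * v) by (unfold v; field; lra).
  assert (Hby : - (1 - b ^ 2) < b * y0 < 1 - b ^ 2).
  { apply Rabs_def2 in H. destruct H as [Ha Hb].
    apply (Rmult_lt_compat_l b) in Ha; [|lra].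
    apply (Rmult_lt_compat_l b) in Hb; [|lra].
    replace (b * ((1 - b ^ 2) / b)) with (1 - b ^ 2) in Ha by (field; lra).
    replace (b * - ((1 - b ^ 2) / b)) with (- (1 - b ^ 2)) in Hb by (field; lra).
    lra. }
  assert (Hv : -1 < v < 1) by nra.
  assert (Hv2 : 0 < 1 - v ^ 2) by nra.
  set (u := sqrt (1 - v ^ 2)).
  assert (Hu : 0 < u) by (apply sqrt_lt_R0; trivial).
  assert (Hu2 : u ^ 2 = 1 - v ^ 2) by (apply pow2_sqrt; lra).
  assert (HKu : 0 < (1 - b ^ 2) * u ^ 2) by nra.
  apply admissible_intro with u v (- u) v; unfold slope, curvature; trivial;
    try lra; rewrite ?Ev; try nra.
  intros Hal. apply aligned_with_origin_det in Hal.
  (* The common ordinate is [y0 / (1 - b^2)]. *)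
  assert (E : u * (b * v + y0) = 0) by lra.
  apply Rmult_integral in E. destruct E as [E|E]; [lra|].
  assert (b ^ 2 * y0 + (1 - b ^ 2) * y0 = 0).
  { replace (b ^ 2 * y0) with (b * (b * y0)) by ring. rewrite Ev.
    rewrite <- (Rmult_0_r (1 - b ^ 2)), <- E. ring. }
  lra.
Qed.

(** On the horizontal axis the slope is [- v (x0 + (1 - b^2) u)], so the pair
    outside the axis is at abscissa [u = - x0 / (1 - b^2)]. *)
Lemma admissible_horizontal_axis (b x0 : R) :
  0 < b < 1 -> x0 ^ 2 + 0 ^ 2 / b ^ 2 < 1 -> x0 <> 0 -> Rabs x0 < 1 - b ^ 2 ->
  admissible (elliptic_domain b x0 0) 0 (2 * PI) (ellipse_param b x0 0).
Proof.
intros hb hin Hx H.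
assert (HK : 0 < 1 - b ^ 2) by nra.
set (u := - x0 / (1 - b ^ 2)).
assert (Eu : x0 = - ((1 - b ^ 2) * u)) by (unfold u; field; lra).
apply Rabs_def2 in H.
assert (Hu : -1 < u < 1) by nra.
assert (Hu2 : 0 < 1 - u ^ 2) by nra.
set (v := sqrt (1 - u ^ 2)).
assert (Hv : 0 < v) by (apply sqrt_lt_R0; trivial).
assert (Hv2 : v ^ 2 = 1 - u ^ 2) by (apply pow2_sqrt; lra).
assert (HKv : 0 < (1 - b ^ 2) * v ^ 2) by nra.
clearbody u. clearbody v.
apply admissible_intro with u v u (- v); unfold slope, curvature; trivial;
  try lra; try (rewrite Eu; nra).
intros Hal. apply aligned_with_origin_det in Hal.
(* The common abscissa is [- b^2 x0 / (1 - b^2)]. *)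
assert (E : (b * v) * (b ^ 2 * u) = 0).
{ replace (b ^ 2 * u) with (u + x0) by (rewrite Eu; ring). lra. }
assert (0 < b * v) by nra. assert (0 < b ^ 2) by nra.
apply Rmult_integral in E. destruct E as [E|E]; [lra|].
apply Rmult_integral in E. destruct E as [E|E]; [lra|]. subst u. lra.
Qed.

(** * The origin off the axes *)

(** Parallel tangents make the two ends opposite points of the ellipse, hence
    the chord, which passes through the origin, also passes through the centre; so
    the tangent at an end is orthogonal to the position of the centre, and the
    slope there reduces to [- (1 - b^2) u v]. *)
Lemma normal_chord_on_axis (b x0 y0 u1 v1 u2 v2 : R) :
  0 < b < 1 -> x0 ^ 2 + y0 ^ 2 / b ^ 2 < 1 ->
  u1 ^ 2 + v1 ^ 2 = 1 -> u2 ^ 2 + v2 ^ 2 = 1 ->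
  slope x0 (b * y0) (1 - b ^ 2) u1 v1 = 0 ->
  slope x0 (b * y0) (1 - b ^ 2) u2 v2 = 0 ->
  aligned_with_origin (u1 + x0, b * v1 + y0) (u2 + x0, b * v2 + y0) ->
  (u1 = u2 /\ v1 = v2) \/ x0 = 0 \/ y0 = 0.
Proof.
intros hb hin H1 H2 S1 S2 [[p q] [s [t [E1 E2]]]].
assert (hb' : 0 < b) by lra.
pose proof (origin_not_on_ellipse b x0 y0 u1 v1 hb' hin H1) as P1.
pose proof (origin_not_on_ellipse b x0 y0 u2 v2 hb' hin H2) as P2.
injection E1 as X1 Y1. injection E2 as X2 Y2.
unfold scal in X1, Y1, X2, Y2; simpl in X1, Y1, X2, Y2.
unfold mult in X1, Y1, X2, Y2; simpl in X1, Y1, X2, Y2.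
rewrite X1, Y1 in P1. rewrite X2, Y2 in P2.
assert (Hs : s <> 0) by (intros ->; lra).
assert (Hpq : 0 < p ^ 2 + q ^ 2).
{ apply Rmult_lt_reg_l with (s ^ 2); [now apply pow2_gt_0|lra]. }
assert (Ht : t <> 0) by (intros ->; lra).
(* The tangents [(- v1, b u1)] and [(- v2, b u2)] are both normal to [(p, q)]. *)
assert (T1 : q * (b * u1) = p * v1).
{ apply Rmult_eq_reg_l with s; [|trivial]. unfold slope in S1.
  replace (s * (q * (b * u1))) with (s * q * (b * u1)) by ring.
  replace (s * (p * v1)) with (s * p * v1) by ring.
  rewrite <- X1, <- Y1. lra. }
assert (T2 : q * (b * u2) = p * v2).
{ apply Rmult_eq_reg_l with t; [|trivial]. unfold slope in S2.
  replace (t * (q * (b * u2))) with (t * q * (b * u2)) by ring.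
  replace (t * (p * v2)) with (t * p * v2) by ring.
  rewrite <- X2, <- Y2. lra. }
assert (Hdet : u1 * v2 - u2 * v1 = 0).
{ assert (p * (u1 * v2 - u2 * v1) = 0).
  { replace (p * (u1 * v2 - u2 * v1)) with (u1 * (p * v2) - u2 * (p * v1)) by ring.
    rewrite <- T1, <- T2. ring. }
  assert (q * b * (u1 * v2 - u2 * v1) = 0).
  { replace (q * b * (u1 * v2 - u2 * v1))
      with ((q * (b * u1)) * v2 - (q * (b * u2)) * v1) by ring.
    rewrite T1, T2. ring. }
  destruct (Req_dec (u1 * v2 - u2 * v1) 0) as [|N]; trivial.
  assert (p = 0) by nra. assert (q * b = 0) by nra. assert (q = 0) by nra.
  subst. lra. }
set (d := u1 * u2 + v1 * v2).
assert (Eu : u2 = d * u1).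
{ transitivity (u2 * (u1 ^ 2 + v1 ^ 2)); [rewrite H1; ring|].
  transitivity (d * u1 - v1 * (u1 * v2 - u2 * v1)); [unfold d; ring|].
  rewrite Hdet. ring. }
assert (Ev : v2 = d * v1).
{ transitivity (v2 * (u1 ^ 2 + v1 ^ 2)); [rewrite H1; ring|].
  transitivity (d * v1 + u1 * (u1 * v2 - u2 * v1)); [unfold d; ring|].
  rewrite Hdet. ring. }
assert (Hd : (d - 1) * (d + 1) = 0).
{ clearbody d. subst u2 v2.
  replace ((d * u1) ^ 2 + (d * v1) ^ 2) with (d ^ 2 * (u1 ^ 2 + v1 ^ 2)) in H2 by ring.
  rewrite H1 in H2. lra. }
clearbody d.
apply Rmult_integral in Hd. destruct Hd as [Hd|Hd].
- left. assert (d = 1) as -> by lra. lra.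
- right. assert (d = -1) as -> by lra.
  assert (Ex : 2 * x0 = (s + t) * p) by lra.
  assert (Ey : 2 * y0 = (s + t) * q) by (rewrite Ev in Y2; lra).
  assert (T0 : b * y0 * u1 = x0 * v1).
  { assert ((s + t) * q * (b * u1) = (s + t) * p * v1)
      by (rewrite 2!Rmult_assoc, T1; ring).
    rewrite <- Ex, <- Ey in H. lra. }
  unfold slope in S1.
  assert (Huv : (1 - b ^ 2) * (u1 * v1) = 0) by lra.
  assert (0 < 1 - b ^ 2) by nra.
  apply Rmult_integral in Huv. destruct Huv as [|Huv]; [lra|].
  apply Rmult_integral in Huv. destruct Huv as [Z|Z]; rewrite Z in *.
  + left. assert (v1 <> 0) by nra. nra.
  + right. assert (u1 <> 0) by nra.
    assert (E0 : (b * u1) * y0 = 0) by lra.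
    apply Rmult_integral in E0. destruct E0 as [E0|]; trivial.
    apply Rmult_integral in E0. lra.
Qed.

Lemma admissible_off_axes (b x0 y0 : R) :
  0 < b < 1 -> x0 ^ 2 + y0 ^ 2 / b ^ 2 < 1 -> x0 <> 0 -> y0 <> 0 ->
  admissible (elliptic_domain b x0 y0) 0 (2 * PI) (ellipse_param b x0 y0).
Proof.
intros hb hin Hx Hy.
assert (HB : b * y0 <> 0) by (apply Rmult_integral_contrapositive; lra).
assert (HK : 1 - b ^ 2 <> 0) by nra.
destruct (exists_nondegenerate_max x0 (b * y0) (1 - b ^ 2))
  as [xi1 [_ [M1 [S1 C1]]]]; trivial.
(* The minimum is the maximum of the opposite polynomial. *)
destruct (exists_nondegenerate_max (- x0) (- (b * y0)) (- (1 - b ^ 2)))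
  as [xi2 [_ [M2 [S2 C2]]]]; try lra.
assert (S2' : slope x0 (b * y0) (1 - b ^ 2) (cos xi2) (sin xi2) = 0)
  by (unfold slope in *; lra).
apply admissible_intro with (cos xi1) (sin xi1) (cos xi2) (sin xi2);
  trivial; try lra; try apply sum_sq_cos_sin.
- unfold curvature in *. lra.
- intros Hal. apply normal_chord_on_axis in Hal; trivial; try apply sum_sq_cos_sin.
  destruct Hal as [[Ec Es]|[|]]; [|tauto|tauto].
  (* Equal maximum and minimum: the energy takes the same value at [(1, 0)] and
     [(-1, 0)], where it differs by [2 x0]. *)
  rewrite Ec, Es in M1. unfold energy in M1, M2.
  pose proof (M1 1 0). pose proof (M1 (-1) 0).
  pose proof (M2 1 0). pose proof (M2 (-1) 0). lra.
Qed.

(** * The characterisation *)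

Lemma aligned_vertical (y1 y2 : R) : aligned_with_origin (0, y1) (0, y2).
Proof.
exists (0, 1), y1, y2.
unfold scal; simpl; unfold prod_scal, scal; simpl; unfold mult; simpl.
split; f_equal; ring.
Qed.

Lemma aligned_horizontal (x1 x2 : R) : aligned_with_origin (x1, 0) (x2, 0).
Proof.
exists (1, 0), x1, x2.
unfold scal; simpl; unfold prod_scal, scal; simpl; unfold mult; simpl.
split; f_equal; ring.
Qed.

(** At the threshold itself the outer pair has merged with an end of the axis, so
    critical points are still confined to the axis. *)
Lemma slope_zero_vertical_axis (B K u v : R) :
  0 < K <= Rabs B -> u ^ 2 + v ^ 2 = 1 -> slope 0 B K u v = 0 -> u = 0.
Proof.
intros HK H1 Hs. unfold slope in Hs.
assert (E : u * (B - K * v) = 0) by lra.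
apply Rmult_integral in E. destruct E as [|E]; trivial.
assert (-1 <= v <= 1) by nra.
assert (v ^ 2 = 1); [|nra].
unfold Rabs in HK. destruct (Rcase_abs B); nra.
Qed.

Lemma slope_zero_horizontal_axis (A K u v : R) :
  0 < K <= Rabs A -> u ^ 2 + v ^ 2 = 1 -> slope A 0 K u v = 0 -> v = 0.
Proof.
intros HK H1 Hs. unfold slope in Hs.
assert (E : v * (A + K * u) = 0) by lra.
apply Rmult_integral in E. destruct E as [|E]; trivial.
assert (-1 <= u <= 1) by nra.
assert (u ^ 2 = 1); [|nra].
unfold Rabs in HK. destruct (Rcase_abs A); nra.
Qed.

Theorem lemma3 (b x0 y0 : R)
  (hb : 0 < b < 1) (hx0 : -1 < x0 < 1) (hy0 : - b < y0 < b)
  (hin : x0 ^ 2 + y0 ^ 2 / b ^ 2 < 1) :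
  ~ admissible (elliptic_domain b x0 y0) 0 (2 * PI) (ellipse_param b x0 y0) <->
  (x0 = 0 /\ Rabs y0 >= (1 - b ^ 2) / b) \/ (y0 = 0 /\ Rabs x0 >= 1 - b ^ 2).
Proof.
assert (hb' : 0 < b) by lra.
assert (HK : 0 < 1 - b ^ 2) by nra.
split.
- intros Hna. destruct (Req_dec x0 0) as [->|Hx].
  + destruct (Rlt_dec (Rabs y0) ((1 - b ^ 2) / b)) as [L|L]; [exfalso|left; lra].
    now apply Hna, admissible_vertical_axis.
  + destruct (Req_dec y0 0) as [->|Hy].
    * destruct (Rlt_dec (Rabs x0) (1 - b ^ 2)) as [L|L]; [exfalso|right; lra].
      now apply Hna, admissible_horizontal_axis.
    * exfalso. now apply Hna, admissible_off_axes.
- intros H [xi1 [xi2 [[N1 _] [[N2 _] Hal]]]]. apply Hal.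
  apply central_configuration_slope in N1, N2; trivial.
  pose proof (sum_sq_cos_sin xi1). pose proof (sum_sq_cos_sin xi2).
  unfold ellipse_param.
  destruct H as [[-> H]|[-> H]].
  + assert (HB : 1 - b ^ 2 <= Rabs (b * y0)).
    { rewrite Rabs_mult, (Rabs_pos_eq b) by lra.
      replace (1 - b ^ 2) with (b * ((1 - b ^ 2) / b)) by (field; lra).
      apply Rmult_le_compat_l; lra. }
    apply slope_zero_vertical_axis in N1, N2; try lra.
    rewrite N1, N2, Rplus_0_r. apply aligned_vertical.
  + rewrite Rmult_0_r in N1, N2.
    apply slope_zero_horizontal_axis in N1, N2; try lra.
    rewrite N1, N2, Rmult_0_r, Rplus_0_r. apply aligned_horizontal.
Qed.
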